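(* Assume that the field of scalars is $\mathbb{R}$ or $\mathbb{C}$. Let $K$ be a compact Hausdorff space with $|K''|=1$. Then $C[1,\omega^2]$ cannot be embedded isometrically into $C(K)$ in an SPR way; that is, there is no linear isometric embedding $T:C[1,\omega^2]\to C(K)$ whose image $T(C[1,\omega^2])$ does stable phase retrieval in $C(K)$.
   Context: For a compact Hausdorff space $K$, $C(K)$ is the Banach lattice of scalar-valued continuous functions on $K$ with the sup norm and pointwise modulus. $K'$ is the set of non-isolated points of $K$ and $K''=(K')'$. $[1,\omega^2]$ is the set of ordinals $\beta$ with $1\le\beta\le\omega^2$ with the order topology, a compact Hausdorff space, and $C[1,\omega^2]$ denotes $C([1,\omega^2])$. A linear subspace $E$ of a (real or complex) Banach lattice $X$ does $C$-stable phase retrieval ($C$-SPR) if $\min_{|\lambda|=1}\|x-\lambda y\|\leq C\,\||x|-|y|\|$ for all $x,y\in E$ (the minimum being over unimodular scalars $\lambda$); it does stable phase retrieval (SPR) if it does $C$-SPR for some constant $C\geq1$. *)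

(* Defs.v *)
From HB Require Import structures.
From mathcomp Require Import all_boot all_order all_algebra.
From mathcomp Require Import all_classical all_reals all_analysis.
From mathcomp Require Export complex.

Set Implicit Arguments.
Unset Strict Implicit.
Unset Printing Implicit Defensive.

Import Order.TTheory GRing.Theory Num.Theory.

Local Open Scope classical_set_scope.
Local Open Scope ring_scope.

(* C(K), as functions with values in F^o, which is F seen as a normed module
   over itself; F stands for a realType R or for R[i]. *)
Definition CK (K : topologicalType) (F : numFieldType) : Type :=
  continuousType K F^o.

Section continuous_functions_lmodule.
Context {K : topologicalType} {F : numFieldType}.
Implicit Types (f g h : CK K F) (a b : F).

HB.instance Definition _ := Choice.on (CK K F).

Lemma CKP f g : (forall x, f x = g x) -> f = g.
Proof. by move=> fg; apply/continuousEP. Qed.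

Lemma CK_zero_continuous : continuous (fun _ : K => 0 : F^o).
Proof. by move=> x; exact: cvg_cst. Qed.

Lemma CK_opp_continuous f : continuous (fun x => - f x : F^o).
Proof. by move=> x; apply: cvgN; exact: cts_fun. Qed.

Lemma CK_add_continuous f g : continuous (fun x => f x + g x : F^o).
Proof. by move=> x; apply: cvgD; exact: cts_fun. Qed.

Lemma CK_scale_continuous a f : continuous (fun x => a *: (f x : F^o) : F^o).
Proof. by move=> x; apply: cvgZl_tmp; exact: cts_fun. Qed.

Lemma CK_abs_continuous f : continuous (fun x => `|f x| : F^o).
Proof.
by move=> x; apply: (@cvg_norm F F^o); exact: cts_fun.
Qed.

Definition CK_zero : CK K F := mkcts CK_zero_continuous.
Definition CK_opp f : CK K F := mkcts (@CK_opp_continuous f).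
Definition CK_add f g : CK K F := mkcts (@CK_add_continuous f g).
Definition CK_scale a f : CK K F := mkcts (@CK_scale_continuous a f).

Fact CK_addA : associative CK_add.
Proof. by move=> f g h; apply: CKP => x; exact: addrA. Qed.
Fact CK_addC : commutative CK_add.
Proof. by move=> f g; apply: CKP => x; exact: addrC. Qed.
Fact CK_add0 : left_id CK_zero CK_add.
Proof. by move=> f; apply: CKP => x; exact: add0r. Qed.
Fact CK_addN : left_inverse CK_zero CK_opp CK_add.
Proof. by move=> f; apply: CKP => x; exact: addNr. Qed.

HB.instance Definition _ :=
  GRing.isZmodule.Build (CK K F) CK_addA CK_addC CK_add0 CK_addN.

Fact CK_scaleA a b f : CK_scale a (CK_scale b f) = CK_scale (a * b) f.
Proof. by apply: CKP => x; exact: scalerA. Qed.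
Fact CK_scale1 : left_id 1 CK_scale.
Proof. by move=> f; apply: CKP => x; exact: scale1r. Qed.
Fact CK_scaleDr : right_distributive CK_scale +%R.
Proof. by move=> a f g; apply: CKP => x; exact: scalerDr. Qed.
Fact CK_scaleDl f : {morph CK_scale^~ f : a b / a + b}.
Proof. by move=> a b; apply: CKP => x; exact: scalerDl. Qed.

HB.instance Definition _ := GRing.Zmodule_isLmodule.Build F (CK K F)
  CK_scaleA CK_scale1 CK_scaleDr CK_scaleDl.

(* The lattice modulus: over the complex field `|f x| is a nonnegative real
   number regarded as a complex one. *)
Definition CK_abs f : CK K F := mkcts (@CK_abs_continuous f).

(* As usual for norms over a numFieldType, the value lies in F. Over R[i] the
   order is z <= w iff w - z is a nonnegative real, so the upper bounds (in
   R[i]) of a nonempty set of reals are its real upper bounds, and `supremum'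
   and `infimum' agree with their real counterparts. *)
Definition supnorm f : F := supremum 0 (range (fun x => `|f x|)).

(* The minimum of `||f - l g||' over the unimodular l; it is attained because
   the unimodular scalars form a compact set. *)
Definition phase_dist f g : F :=
  infimum 0 [set supnorm (f - l *: g) | l in [set l : F | `|l| = 1]].

Definition does_CSPR (C : F) (E : set (CK K F)) : Prop :=
  forall f g, E f -> E g -> phase_dist f g <= C * supnorm (CK_abs f - CK_abs g).

Definition does_SPR (E : set (CK K F)) : Prop :=
  exists2 C : F, 1 <= C & does_CSPR C E.

End continuous_functions_lmodule.

Definition isometric_embedding (F : numFieldType) (L K : topologicalType)
    (T : {linear CK L F -> CK K F}) : Prop :=
  forall f, supnorm (T f) = supnorm f.

Definition embeds_isometrically_SPR (F : numFieldType) (L K : topologicalType)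
    : Prop :=
  exists T : {linear CK L F -> CK K F},
    isometric_embedding T /\ does_SPR (range T).

Definition derived_set (K : topologicalType) (A : set K) : set K :=
  A `\` isolated A.

(* The ordinals below omega^3 in Cantor normal form: (a, (b, c)) stands for
   omega^2 * a + omega * b + c, and the ordinal order is the lexicographic
   one. *)
Definition ord_below_omega3 : Type := (nat *l (nat *l nat))%type.
HB.instance Definition _ := Order.Total.on ord_below_omega3.

Definition ord_one : ord_below_omega3 := (0, (0, 1))%N.
Definition ord_omega2 : ord_below_omega3 := (1, (0, 0))%N.

Definition ord_interval : Type :=
  {b : ord_below_omega3 | (ord_one <= b <= ord_omega2)%O}.
HB.instance Definition _ := SubChoice.on ord_interval.
HB.instance Definition _ :=
  [SubChoice_isSubOrder of ord_interval by <: with Order.Disp tt tt].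

Definition ord_interval_top : topologicalType := order_topology ord_interval.

(* Main.v *)
Require Import Defs.
From mathcomp Require Import all_boot all_order all_algebra.
From mathcomp Require Import all_classical all_reals all_analysis.
From mathcomp Require Import zify.

(* Let T be the embedding and write chi_A for the indicator of a clopen set A.
   Since T is isometric, sum_j |T chi_(A_j)| <= 1 pointwise on K whenever the
   A_j are pairwise disjoint.  Let U_n be disjoint clopen neighbourhoods of the
   limit ordinals omega * (n + 1), and let H be the complement of U_0.

   For isolated points s of U_n, the functions |T chi_s| peak (with value 1) at
   distinct points of K, at which |T chi_(U_n)| = 1 as well; these accumulate at
   a point of K'.  Letting n vary, |T chi_H| = 1 at infinitely many points
   of K', hence at p, where K'' = {p}.  If s is isolated in U_0, then
   |T chi_s| <= 1 - |T chi_H|, so the sets {|T chi_s| >= e} all live in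
   {|T chi_H| <= 1 - e}, which misses p and thus contains only finitely many
   points of K'.  For all but finitely many s, |T chi_s| < e at these points,
   whence {|T chi_s| >= e} is compact and misses K', so it is finite; for all
   but finitely many t, |T chi_t| < e on this finite set.  Therefore T chi_s and
   T chi_t are e-almost disjoint, and T (chi_s + chi_t), T (chi_s - chi_t)
   violate stable phase retrieval. *)

Set Implicit Arguments.
Unset Strict Implicit.
Unset Printing Implicit Defensive.

Import Order.TTheory GRing.Theory Num.Theory.
Import numFieldNormedType.Exports.

Local Open Scope classical_set_scope.
Local Open Scope ring_scope.

(** * Derived sets and compactness *)

Section derived_sets.
Context {K : topologicalType}.
Implicit Types A B : set K.

Lemma derived_setS A B : A `<=` B -> derived_set A `<=` derived_set B.
Proof.
move=> AB x [Ax nAx]; split; first exact: AB.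
move=> [_ [V Vx VB]]; apply: nAx; split; first exact/mem_set.
exists V => //; apply/seteqP; split=> [y [Vy Ay]|_ ->].
  by rewrite -VB; split=> //; exact: AB.
by split=> //; exact: nbhs_singleton.
Qed.

Lemma closed_derived_set A : closed A -> closed (derived_set A).
Proof.
move=> cA x xA; split.
  by apply: cA => V /xA[y [[Ay _] Vy]]; exists y.
move=> [_ [V Vx VA]]; have [y [[Ay nAy] Vy]] := xA _ Vx.
have yx : y = x by rewrite -[_ = _]/([set x] y) -VA.
by apply: nAy; rewrite yx; split; [apply/mem_set; rewrite -yx | exists V].
Qed.

(** The sets containing all but finitely many points of [A] form a proper filter. A cluster point of
    it is not isolated in [A], because [A] minus that point is still a member. *)
Lemma compact_derived_set A :
  compact A -> infinite_set A -> derived_set A !=set0.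
Proof.
move=> cA infA.
pose F : set_system K := [set P | finite_set (A `\` P)].
have FF : ProperFilter F.
  split; last split.
  - by rewrite /F /= setD0.
  - by rewrite /F /= setDT; exact: finite_set0.
  - by move=> P Q PF QF; rewrite /F /= setDIr finite_setU.
  - by move=> P Q PQ; apply: sub_finite_set; exact: setDS.
have [|x [Ax xF]] := cA F FF.
  by rewrite /F /= setDv; exact: finite_set0.
exists x; split=> // -[_ [V Vx VA]].
have FAx : F (A `\ x).
  rewrite /F /=; apply: (@sub_finite_set _ _ [set x]); last exact: finite_set1.
  by move=> y [Ay /not_andP[//|/contrapT]].
have [y [[Ay yx] Vy]] := xF _ _ FAx Vx.
by apply: yx; rewrite -VA.
Qed.

End derived_sets.

Lemma injective_infinite_set (T : Type) (f : nat -> T) (A : set T) :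
  injective f -> (forall n, A (f n)) -> infinite_set A.
Proof.
move=> fI fA finA; apply: infinite_nat.
rewrite (_ : setT = f @^-1` A); last by apply/seteqP; split=> // n _; exact: fA.
by apply: finite_preimage => // m n _ _; exact: fI.
Qed.

(** * Sup norms that are attained *)

Section sup_norm.
Context {K : topologicalType} {F : numFieldType}.
Implicit Types f g : CK K F.

Lemma CK_addE f g x : (f + g) x = f x + g x. Proof. by []. Qed.
Lemma CK_oppE f x : (- f) x = - f x. Proof. by []. Qed.
Lemma CK_scaleE a f x : (a *: f) x = a * f x. Proof. by []. Qed.
Lemma CK_absE f x : CK_abs f x = `|f x|. Proof. by []. Qed.
Lemma CK_sumE (I : Type) (s : seq I) (f : I -> CK K F) x :
  (\sum_(i <- s) f i) x = \sum_(i <- s) f i x.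
Proof.
apply: (big_morph (fun g : CK K F => g x)) => // g h; exact: CK_addE.
Qed.

Lemma supnorm_attained f x0 :
  (forall x, `|f x| <= `|f x0|) -> supnorm f = `|f x0|.
Proof.
move=> fmax; rewrite /supnorm /supremum ifF; last first.
  by apply/negbTE/set0P; exists `|f x0|; exists x0.
apply: xget_subset1; last exact: is_subset1_supremums.
by split=> [_ [x _ <-]//|y]; apply; exists x0.
Qed.

Lemma closed_norm_ge f c : c \is Num.real -> closed [set x | c <= `|f x|].
Proof.
move=> cR x xf; rewrite /= real_leNgt ?normr_real//; apply/negP => fc.
have /xf : \forall y \near x, `|f y| < c.
  by apply: (@cvgr_norm_lt F F^o) fc; exact: cts_fun.
by case=> y [/= cy yc]; move: (le_lt_trans cy yc); rewrite ltxx.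
Qed.

Lemma closed_norm_le f c : c \is Num.real -> closed [set x | `|f x| <= c].
Proof.
move=> cR x xf; rewrite /= real_leNgt ?normr_real//; apply/negP => fc.
have /xf : \forall y \near x, c < `|f y|.
  by apply: (@cvgr_norm_gt F F^o) fc; exact: cts_fun.
by case=> y [/= yc cy]; move: (le_lt_trans yc cy); rewrite ltxx.
Qed.

(** The extreme value theorem fails over a general [numFieldType], so this is carried as a
    hypothesis until compactness provides it for [R] and [R[i]]. *)
Definition attains_max f := exists x0, forall x, `|f x| <= `|f x0|.

Lemma norm_le_supnorm f x : attains_max f -> `|f x| <= supnorm f.
Proof. by move=> [x0 fmax]; rewrite (supnorm_attained fmax). Qed.

Lemma supnorm_le f c :
  attains_max f -> (forall x, `|f x| <= c) -> supnorm f <= c.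
Proof. by move=> [x0 fmax] fc; rewrite (supnorm_attained fmax). Qed.

End sup_norm.

(** * Indicators of clopen sets *)

Section indicators.
Context {L : topologicalType} {F : numFieldType}.

Lemma indic_clopen_continuous (A : set L) :
  clopen A -> continuous (\1_A : L -> F^o).
Proof.
move=> [oA cA] x; have [Ax|nAx] := pselect (A x).
  apply: cvg_near_cst; have : nbhs x A by exact: open_nbhs_nbhs.
  apply: filterS => y Ay; rewrite !indicE !mem_set//.
apply: cvg_near_cst; have : nbhs x (~` A).
  by apply: open_nbhs_nbhs; split=> //; exact: closed_openC.
by apply: filterS => y Ay; rewrite !indicE !memNset.
Qed.

(* Equal to 0 when [A] is not clopen. *)
Definition chi (A : set L) : CK L F :=
  if pselect (clopen A) is left cA
  then mkcts (indic_clopen_continuous cA) else 0.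

Lemma chiE A x : clopen A -> chi A x = (x \in A)%:R.
Proof.
by rewrite /chi; case: pselect => // cA _; rewrite -[LHS]/(\1_A x) indicE.
Qed.

Lemma chiU A B : clopen A -> clopen B -> A `&` B = set0 ->
  chi (A `|` B) = chi A + chi B.
Proof.
move=> cA cB AB; apply: CKP => x.
rewrite CK_addE !chiE//; last exact: clopenU.
rewrite in_setU; have [xA|] := boolP (x \in A); have [xB|] := boolP (x \in B).
- by have : (A `&` B) x; [split; exact: set_mem | rewrite AB].
- by rewrite addr0.
- by rewrite add0r.
- by rewrite addr0.
Qed.

Lemma supnorm_sum_chi (J : choiceType) (A : J -> set L) (s : seq J)
    (a : J -> F) (j0 : J) :
    (forall j, clopen (A j)) -> (forall j, A j !=set0) -> trivIset setT A ->
    uniq s -> j0 \in s -> (forall j, j \in s -> `|a j| <= `|a j0|) ->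
  supnorm (\sum_(j <- s) a j *: chi (A j)) = `|a j0|.
Proof.
move=> cA A0 dA us j0s aj0.
have sumE j x : j \in s -> A j x -> (\sum_(i <- s) a i *: chi (A i)) x = a j.
  move=> js Ajx; rewrite CK_sumE (bigD1_seq j)//= CK_scaleE chiE//.
  rewrite mem_set// mulr1 big1 ?addr0// => i ij.
  rewrite CK_scaleE chiE// memNset ?mulr0// => Aix.
  by move/eqP: ij; apply; apply: dA => //; exists x.
have [x0 x0A] := A0 j0.
rewrite (@supnorm_attained _ _ _ x0); first by rewrite (sumE j0).
move=> x; rewrite (sumE j0 x0)//.
have [[j js Ajx]|nA] := pselect (exists2 j, j \in s & A j x).
  by rewrite (sumE j)// aj0.
rewrite CK_sumE big_seq big1 ?normr0// => j js.
by rewrite CK_scaleE chiE// memNset ?mulr0// => Ajx; apply: nA; exists j.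
Qed.

End indicators.

(** * Images of indicators under an isometry *)

Section isometries.
Context {F : numFieldType} {L K : topologicalType}.
Context (T : {linear CK L F -> CK K F}) (isoT : isometric_embedding T).
Context (max_attained : forall f : CK K F, attains_max f).
Implicit Types A B : set L.

(** Unimodular factors [a j] turn each value at [k] into its modulus; the combination of disjoint
    indicators with these coefficients has norm 1, and so has its image. *)
Lemma sum_norm_image_chi (J : choiceType) (A : J -> set L) (s : seq J) (k : K) :
    (forall j, clopen (A j)) -> (forall j, A j !=set0) -> trivIset setT A ->
    uniq s ->
  \sum_(j <- s) `|T (chi (A j)) k| <= 1.
Proof.
move=> cA A0 dA us; case: s us => [|j0 s] us; first by rewrite big_nil ler01.
(* The value 1 at [z = 0] keeps every factor unimodular. *)
pose a j := let z := T (chi (A j)) k in if z == 0 then 1 else `|z| / z.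
have a1 j : `|a j| = 1.
  rewrite /a; case: ifPn => [_|z0]; first exact: normr1.
  by rewrite normf_div normr_id divff// normr_eq0.
have az j : a j * T (chi (A j)) k = `|T (chi (A j)) k|.
  rewrite /a; case: ifPn => [/eqP->|z0]; first by rewrite mulr0 normr0.
  by rewrite divfK.
pose f := \sum_(j <- j0 :: s) a j *: chi (A j).
have Tfk : T f k = \sum_(j <- j0 :: s) `|T (chi (A j)) k|.
  rewrite linear_sum CK_sumE; apply: eq_bigr => j _.
  by rewrite linearZ CK_scaleE az.
have := norm_le_supnorm k (max_attained (T f)).
rewrite isoT /f (@supnorm_sum_chi _ _ _ _ _ _ j0)// ?mem_head//; last first.
  by move=> j _; rewrite !a1.
by rewrite a1 -/f Tfk ger0_norm// sumr_ge0.
Qed.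

Lemma norm_image_chi2 A B k : clopen A -> clopen B -> A !=set0 -> B !=set0 ->
  A `&` B = set0 -> `|T (chi A) k| + `|T (chi B) k| <= 1.
Proof.
move=> cA cB A0 B0 AB.
have := @sum_norm_image_chi bool (fun b => if b then A else B)
  [:: true; false] k.
rewrite !big_cons big_nil addr0; apply=> //; [by case|by case|].
apply/trivIsetP => -[] [] // _ _ _; by rewrite // setIC.
Qed.

Lemma norm_image_chi_attained A : clopen A -> A !=set0 ->
  exists k, `|T (chi A) k| = 1.
Proof.
move=> cA [x Ax]; have [k kmax] := max_attained (T (chi A)).
exists k; rewrite -(supnorm_attained kmax) isoT.
have chi_x : `|chi A x : F| = 1 by rewrite chiE// mem_set// normr1.
rewrite (@supnorm_attained _ _ _ x)// chi_x => y.
by rewrite chiE//; case: (y \in A); rewrite ?normr1 ?normr0.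
Qed.

(** The image for [A] uses up the whole bound 1 at [k], so the image for the rest of [B] vanishes
    there. *)
Lemma norm_image_chi_sub A B k : clopen A -> clopen B -> A !=set0 -> A `<=` B ->
  1 <= `|T (chi A) k| -> 1 <= `|T (chi B) k|.
Proof.
move=> cA cB A0 AB Ak.
have [BA|/set0P BA0] := eqVneq (B `\` A) set0.
  by rewrite (_ : B = A)//; apply/seteqP; split=> //; rewrite -setD_eq0.
have cBA : clopen (B `\` A).
  by rewrite setDE; apply: clopenI => //; exact: clopenC.
have dBA : A `&` (B `\` A) = set0 by rewrite setDE setICA setICr setI0.
have BAk : T (chi (B `\` A)) k = 0.
  apply/eqP; rewrite -normr_le0 -(lerD2l 1) addr0.
  by apply: le_trans (norm_image_chi2 k cA cBA A0 BA0 dBA); rewrite lerD2r.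
by rewrite -(setDUK AB) chiU// linearD CK_addE BAk addr0.
Qed.

(** Any [n] such indices would already push the sum of the moduli above 1. *)
Lemma finite_norm_image_chi_ge (A : nat -> set L) (e : F) (n : nat) k :
    (forall j, clopen (A j)) -> (forall j, A j !=set0) -> trivIset setT A ->
    0 <= e -> 1 < n%:R * e ->
  finite_set [set j | e <= `|T (chi (A j)) k|].
Proof.
move=> cA A0 dA e0 ne; apply: contrapT => /(infinite_set_fset n)[B Be Bn].
have := sum_norm_image_chi k cA A0 dA (finmap.fset_uniq B).
apply/negP; rewrite -real_ltNge ?real1 ?ger0_real ?sumr_ge0//.
apply: (lt_le_trans ne).
have : n%:R * e <= \sum_(j <- finmap.enum_fset B) e.
  rewrite big_const_seq count_predT iter_addr_0 -[leRHS]mulr_natl.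
  by rewrite ler_wpM2r// ler_nat.
move/le_trans; apply.
by rewrite big_seq [leRHS]big_seq; apply: ler_sum => j jB; exact: Be.
Qed.

End isometries.

(** * Almost disjoint images and the phase retrieval constant *)

Lemma le_infimum (d : Order.disp_t) (X : porderType d) (S : set X) (x0 c : X) :
  S !=set0 -> infimums S !=set0 -> lbound S c -> (c <= infimum x0 S)%O.
Proof.
move=> S0 [m Sm] Sc; rewrite /infimum ifF; last exact/negbTE/set0P.
rewrite (xget_subset1 _ Sm); last exact: is_subset1_infimums.
exact: Sm.2.
Qed.

(** The moduli of [f] and [g] below differ by at most [e *+ 2], while their phase distance is at
    least 1. The hypothesis on infima ensures that [phase_dist] is a genuine infimum and not the
    default value. *)
Lemma CSPR_almost_disjoint (F : numFieldType) (L K : topologicalType)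
    (T : {linear CK L F -> CK K F}) (C e : F) (A B : set L) :
    isometric_embedding T ->
    (forall f : CK K F, attains_max f) ->
    (forall S : set F, S !=set0 -> (forall x, S x -> 0 <= x) ->
      infimums S !=set0) ->
    0 <= C -> does_CSPR C (range T) ->
    clopen A -> clopen B -> A !=set0 -> B !=set0 -> A `&` B = set0 ->
    (forall k, `|T (chi A) k| <= e \/ `|T (chi B) k| <= e) ->
  1 <= C * (e *+ 2).
Proof.
move=> isoT maxK infF C0 spr cA cB A0 B0 AB small.
pose f := T (chi A + chi B); pose g := T (chi A - chi B).
have supfg : supnorm (CK_abs f - CK_abs g) <= e *+ 2.
  apply: supnorm_le => // k; rewrite CK_addE CK_oppE !CK_absE /f /g.
  rewrite linearD linearB !CK_addE CK_oppE.
  set a := T (chi A) k; set b := T (chi B) k.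
  (* By the reverse triangle inequality, comparing [a + b] with [b - a] leaves [a *+ 2], and
     comparing it with [a - b] leaves [b *+ 2]. *)
  have [ae|be] := small k.
    rewrite -(distrC b); apply: le_trans (ler_dist_dist _ _) _.
    rewrite (_ : _ - _ = a *+ 2); first by rewrite normrMn lerMn2r ae orbT.
    by rewrite opprB addrACA subrr addr0 mulr2n.
  apply: le_trans (ler_dist_dist _ _) _.
  rewrite (_ : _ - _ = b *+ 2); first by rewrite normrMn lerMn2r be orbT.
  by rewrite opprB [b - a]addrC addrACA subrr add0r mulr2n.
have /le_trans : 1 <= phase_dist f g; last first.
  apply; apply: le_trans (ler_wpM2l C0 supfg).
  by apply: spr; [exists (chi A + chi B)|exists (chi A - chi B)].
have dist_ge1 (l : F) : 1 <= supnorm (f - l *: g).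
  rewrite /f /g -linearZ -linearB isoT.
  pose a (b : bool) : F := if b then 1 - l else 1 + l.
  have -> : chi A + chi B - l *: (chi A - chi B) =
      \sum_(b <- [:: true; false]) a b *: chi (if b then A else B).
    rewrite !big_cons big_nil addr0 /a scalerBr scalerBl scalerDl !scale1r.
    by rewrite opprB [l *: chi B - _]addrC addrACA.
  (* The coefficients [1 - l] and [1 + l] add up to 2, so the larger modulus, which is the norm, is
     at least 1. *)
  have a2 : 2 <= `|a true| + `|a false|.
    apply: le_trans (ler_normD _ _).
    by rewrite /a addrACA addNr addr0 -mulr2n ger0_norm ?ler0n.
  have [b0 b0max] : exists b0, forall b, `|a b| <= `|a b0|.
    have /orP[tf|ft] := real_leVge (normr_real (a true)) (normr_real (a false)).
      by exists false => -[].
    by exists true => -[].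
  rewrite (@supnorm_sum_chi _ _ _ _ _ _ b0)//; first last.
  - by case: (b0).
  - by apply/trivIsetP => -[] [] // _ _ _; rewrite // setIC.
  - by case.
  - by case.
  rewrite -(ler_pMn2r (n := 2))//; apply: le_trans a2 _.
  by rewrite mulr2n lerD.
apply: le_infimum.
- by exists (supnorm (f - 1 *: g)), 1 => //=; rewrite normr1.
- apply: infF; first by exists (supnorm (f - 1 *: g)), 1 => //=; rewrite normr1.
  by move=> _ [l _ <-]; exact: le_trans ler01 (dist_ge1 l).
- by move=> _ [l _ <-]; exact: dist_ge1.
Qed.

(** * The obstruction for an abstract domain [L] *)

Section no_SPR_embedding.
Context {F : numFieldType} {L K : topologicalType}.
Context (T : {linear CK L F -> CK K F}) (isoT : isometric_embedding T).
Context (K_compact : compact [set: K])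
  (max_attained : forall f : CK K F, attains_max f).
Context (p : K) (K_derived2 : derived_set (derived_set [set: K]) = [set p]).
Context (U : nat -> set L) (x : nat -> nat -> L).
Context (U_clopen : forall n, clopen (U n)) (disjU : trivIset setT U)
  (clopen1 : forall n c, clopen [set x n c]) (Ux : forall n c, U n (x n c))
  (x_inj : forall n, injective (x n)).

Let closed_compact (A : set K) : closed A -> compact A.
Proof. by move=> cA; exact: subclosed_compact K_compact _. Qed.

Let trivIset1 n : trivIset setT (fun c => [set x n c]).
Proof. by move=> c c' _ _ [_ [->]] /x_inj. Qed.

Let U0 n : U n !=set0. Proof. by exists (x n 0%N). Qed.

Lemma limit_peak n :
  exists2 k, derived_set [set: K] k & 1 <= `|T (chi (U n)) k|.
Proof.
have /choice[k k1] c : exists k, `|T (chi [set x n c]) k| = 1.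
  by apply: norm_image_chi_attained => //; exists (x n c).
have k_inj : injective k.
  move=> c c' kk; apply: contrapT => cc'.
  have : `|T (chi [set x n c]) (k c)| + `|T (chi [set x n c']) (k c)| <= 1.
    apply: norm_image_chi2 => //; [by exists (x n c)|by exists (x n c')|].
    by apply/eqP/negbNE/negP => /set0P[y [-> /x_inj]].
  by rewrite k1 kk k1 -[leRHS]addr0 lerD2l ler10.
pose D := [set k | 1 <= `|T (chi (U n)) k|].
have cD : closed D by exact: closed_norm_ge.
have [|q Dq] := compact_derived_set (closed_compact cD).
  apply: (injective_infinite_set k_inj) => c.
  apply: (norm_image_chi_sub isoT max_attained _ _ (A := [set x n c])) => //.
  - by exists (x n c).
  - by move=> _ ->; exact: Ux.
  - by rewrite k1.
by exists q; [exact: derived_setS Dq|exact: Dq.1].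
Qed.

Let H := ~` U 0.

Let clopenH : clopen H. Proof. exact: clopenC. Qed.

Let UH n : U n.+1 `<=` H.
Proof.
move=> y Uy U0y.
by have /(_ I I (ex_intro _ y (conj Uy U0y))) := @disjU n.+1 0%N.
Qed.

Lemma norm_image_chi_tail : 1 <= `|T (chi H) p|.
Proof.
have /choice[q qP] n : exists k,
    derived_set [set: K] k /\ 1 <= `|T (chi (U n.+1)) k|.
  by have [k] := limit_peak n.+1; exists k.
have q_inj : injective q.
  move=> m n qmn; apply: contrapT => mn.
  have : `|T (chi (U m.+1)) (q m)| + `|T (chi (U n.+1)) (q m)| <= 1.
    apply: norm_image_chi2 => //.
    apply/eqP/negbNE/negP => /set0P[y Uy].
    by have /(_ I I (ex_intro _ y Uy))[] := @disjU m.+1 n.+1.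
  have := lerD (qP m).2 (qP n).2; rewrite -qmn => /le_trans /[apply].
  by rewrite -[leRHS]addr0 lerD2l ler10.
pose E := derived_set [set: K] `&` [set k | 1 <= `|T (chi H) k|].
have cE : closed E.
  by apply: closedI; [exact: closed_derived_set|exact: closed_norm_ge].
have [|k Ek] := compact_derived_set (closed_compact cE).
  apply: (injective_infinite_set q_inj) => n; split; first exact: (qP n).1.
  apply: (norm_image_chi_sub isoT max_attained _ _ (U0 n.+1)) => //.
  exact: (qP n).2.
have : derived_set (derived_set [set: K]) k by apply: derived_setS Ek => ? [].
by rewrite K_derived2 => <-; case: Ek => -[].
Qed.

(** The hypothesis on [n] says that [e] is not infinitesimal, as the counting of indices with value
    at least [e] requires. *)
Lemma CSPR_bound (C e : F) n : 0 <= C -> does_CSPR C (range T) ->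
    (forall S : set F, S !=set0 -> (forall x, S x -> 0 <= x) ->
      infimums S !=set0) ->
    0 < e -> 1 < n%:R * e ->
  1 <= C * (e *+ 2).
Proof.
move=> C0 spr infF e0 ne.
have eR : e \is Num.real by exact: gtr0_real.
have x0 c : [set x 0%N c] !=set0 by exists (x 0%N c).
have xH c : [set x 0%N c] `&` H = set0.
  by apply/eqP/negbNE/negP => /set0P[y [->]]; apply; exact: Ux.
have H0 : H !=set0 by have [y /UH] := U0 1; exists y.
have finite_ge k : finite_set [set c | e <= `|T (chi [set x 0%N c]) k|].
  exact: (@finite_norm_image_chi_ge _ _ _ _ isoT max_attained _ e n k
    (clopen1 0%N) x0 (@trivIset1 0%N) (ltW e0) ne).
have finite_bad (W : set K) : finite_set W ->
    finite_set (\bigcup_(k in W) [set c | e <= `|T (chi [set x 0%N c]) k|]).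
  by move=> finW; apply: bigcup_finite.
(* Near [p] the functional [f |-> T f k] is almost concentrated on [H]; so all
   the [T (chi [set x 0 c])] are small there, uniformly in [c]. *)
pose W := derived_set [set: K] `&` [set k | `|T (chi H) k| <= 1 - e].
(* If [W] were infinite, it would have a cluster point in K'', that is [p], where
   [norm_image_chi_tail] contradicts the bound defining [W]. *)
have finW : finite_set W.
  apply: contrapT => /compact_derived_set[|k Wk].
    apply: closed_compact; apply: closedI; first exact: closed_derived_set.
    by apply: closed_norm_le; rewrite realB ?real1.
  have : derived_set (derived_set [set: K]) k by apply: derived_setS Wk => ? [].
  rewrite K_derived2 => kp; have [[_ kH] _] := Wk.
  have := le_trans norm_image_chi_tail; rewrite -kp => /(_ _ kH).
  by rewrite -subr_ge0 addrAC subrr add0r oppr_ge0 lt_geF.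
have /infinite_setN0[c [_ cW]] :=
  infinite_setD infinite_nat (finite_bad W finW).
pose A := [set k | e <= `|T (chi [set x 0%N c]) k|].
(* A cluster point of [A] would lie in K'; disjointness from [H] would then put it in [W], which the
   choice of [c] forbids. *)
have finA : finite_set A.
  apply: contrapT => /compact_derived_set[|k Ak].
    by apply: closed_compact; exact: closed_norm_ge.
  have eA : e <= `|T (chi [set x 0%N c]) k| := Ak.1.
  apply: cW; exists k => //; split; first exact: derived_setS Ak.
  have := norm_image_chi2 isoT max_attained k (clopen1 0%N c) clopenH
    (x0 c) H0 (xH c).
  by rewrite /= lerBrDl; apply: le_trans; rewrite lerD2r.
have finc : finite_set [set c] by exact: finite_set1.
(* The image for [d] is below [e] on the finite set [A], and the image for [c] is below [e] off
   [A]. *)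
have /infinite_setN0[d [[_ dc] dA]] :=
  infinite_setD (infinite_setD infinite_nat finc) (finite_bad A finA).
apply: (CSPR_almost_disjoint isoT max_attained infF C0 spr
  (clopen1 0%N c) (clopen1 0%N d) (x0 c) (x0 d)).
  by apply/eqP/negbNE/negP => /set0P[y [-> /x_inj cd]]; exact/dc/esym.
move=> k; have [Ak|nAk] := pselect (A k); [right|left].
  rewrite real_leNgt ?normr_real//; apply/negP => /ltW ek.
  by apply: dA; exists k.
by rewrite real_leNgt ?normr_real//; apply/negP => /ltW ek; exact: nAk.
Qed.

Lemma not_SPR_isometry :
    (forall S : set F, S !=set0 -> (forall x, S x -> 0 <= x) ->
      infimums S !=set0) ->
    (forall c : F, 0 <= c -> exists n, c <= n%:R) ->
  ~ does_SPR (range T).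
Proof.
move=> infF archiF [C C1 spr].
have C0 : 0 <= C := le_trans ler01 C1.
have [n Cn] := archiF _ C0.
have n0 : (0 < n)%N by rewrite -(ltr_nat F) (lt_le_trans ltr01)// (le_trans C1).
have n4 : (0 : F) < (4 * n)%:R by rewrite ltr0n muln_gt0.
(* As [C <= n], the choice e = 1/(4n) gives 2Ce <= 1/2, while (4n + 1)e > 1. *)
have := @CSPR_bound C (4 * n)%:R^-1 (4 * n).+1 C0 spr infF.
rewrite invr_gt0 n4 -natr1 mulrDl divff ?gt_eqF// ltrDl mul1r invr_gt0 n4.
move=> /(_ isT isT); apply/negP; rewrite -real_ltNge ?real1//; last first.
  by rewrite ger0_real// mulr_ge0// mulrn_wge0// invr_ge0 ltW.
rewrite mulrnAr -mulrnAl ltr_pdivrMr// mul1r.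
apply: (@le_lt_trans _ _ (n%:R *+ 2)); first by rewrite lerMn2r Cn orbT.
by rewrite -mulrnA ltr_nat mulnC ltn_pmul2r.
Qed.

End no_SPR_embedding.

(** * The scalar hypotheses over the reals *)

Section real_scalars.
Context {R : realType}.

Lemma real_attains_max (K : topologicalType) (f : CK K R) :
  compact [set: K] -> [set: K] !=set0 -> attains_max f.
Proof.
move=> cK K0.
have [|c _ cmax] := compact_EVT_max (f := fun x => `|f x|) K0 cK.
  by apply: continuous_subspaceT => x; exact: (@CK_abs_continuous _ R f x).
by exists c => x; apply: cmax; exact: mem_set.
Qed.

Lemma real_infimums (S : set R) :
  S !=set0 -> (forall x, S x -> 0 <= x) -> infimums S !=set0.
Proof.
move=> S0 Sge0; exists (inf S); split=> [x Sx|y yS].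
  by apply: ge_inf => //; exists 0 => y /Sge0.
exact: lb_le_inf.
Qed.

Lemma real_le_nat (c : R) : exists n, c <= n%:R.
Proof.
exists (Num.bound `|c|).
exact: ltW (le_lt_trans (ler_norm c) (archi_boundP (normr_ge0 c))).
Qed.

End real_scalars.

(** * The scalar hypotheses over [R[i]], reduced to real parts *)

Section complex_scalars.
Context {R : realType}.

Lemma Re_continuous : continuous (@complex.Re R : R[i]^o -> R).
Proof.
move=> z; apply/(@cvgrPdist_lt _ _ _ (nbhs (z : R[i]^o))) => e e0.
have ec0 : 0 < e%:C%C by rewrite ltcR.
have : nbhs (z : R[i]^o) (ball (z : R[i]^o) e%:C%C) by exact: nbhsx_ballx.
apply: (@filterS _ (nbhs (z : R[i]^o))) => w.
move=> /(le_lt_trans (normc_ge_Re _)); rewrite ltcR.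
by case: (z) (w) => [? ?] [? ?].
Qed.

(** Nonnegative elements of [R[i]] have zero imaginary part. *)
Lemma complex_ge0_le (z w : R[i]) : 0 <= z -> 0 <= w ->
  (z <= w) = (complex.Re z <= complex.Re w).
Proof.
case: z w => [a b] [c d]; rewrite !lecE /= => /andP[/eqP-> _] /andP[/eqP-> _].
by rewrite eqxx.
Qed.

Lemma complex_attains_max (K : topologicalType) (f : CK K R[i]) :
  compact [set: K] -> [set: K] !=set0 -> attains_max f.
Proof.
move=> cK K0.
have [|c _ cmax] := compact_EVT_max (f := fun x => complex.Re `|f x|) K0 cK.
  apply: continuous_subspaceT => x.
  apply: (@continuous_comp _ R[i]^o R (CK_abs f) (@complex.Re R)).
    exact: CK_abs_continuous.
  exact: Re_continuous.
by exists c => x; rewrite complex_ge0_le//; apply: cmax; exact: mem_set.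
Qed.

Lemma complex_infimums (S : set R[i]) :
  S !=set0 -> (forall x, S x -> 0 <= x) -> infimums S !=set0.
Proof.
move=> [s0 Ss0] Sge0.
have [|_ [s Ss <-]|m [mS mmax]] := @real_infimums R (@complex.Re R @` S).
- by exists (complex.Re s0), s0.
- by have := Sge0 _ Ss; rewrite lecE => /andP[].
have m0 : 0 <= m.
  by apply: mmax => _ [s Ss <-]; have := Sge0 _ Ss; rewrite lecE => /andP[].
exists m%:C%C; split=> [s Ss|l lS].
  by rewrite complex_ge0_le ?lecR ?Sge0//=; apply: mS; exists s.
(* Comparable complex numbers share their imaginary part, and [l] lies below the real number
   [s0]. *)
have Iml : complex.Im l = 0.
  have := lS _ Ss0; rewrite lecE => /andP[/eqP <- _].
  by have := Sge0 _ Ss0; rewrite lecE => /andP[/eqP].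
rewrite lecE /= Iml eqxx /=; apply: mmax => _ [s Ss <-].
by have := lS _ Ss; rewrite lecE => /andP[].
Qed.

Lemma complex_le_nat (c : R[i]) : 0 <= c -> exists n, c <= n%:R.
Proof.
move=> c0; have [n cn] := real_le_nat (complex.Re c).
exists n; rewrite complex_ge0_le// -(rmorph_nat (@real_complex R)).
exact: cn.
Qed.

End complex_scalars.

(** * Clopen intervals of ordinals *)

Section ordinals.

Lemma ord_below_omega2_subproof (n c : nat) :
  (ord_one <= ((0%N, (n, c.+1)) : ord_below_omega3) <= ord_omega2)%O.
Proof. by case: n. Qed.

(* The ordinal [omega * n + c + 1]. *)
Definition ord_pt (n c : nat) : ord_interval_top :=
  exist (fun b => is_true (ord_one <= b <= ord_omega2)%O) _
    (ord_below_omega2_subproof n c).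

Lemma ord_pt_le n c m d :
  (ord_pt n c <= ord_pt m d)%O = (n < m)%N || (n == m) && (c <= d)%N.
Proof.
rewrite -[LHS]/(((n, c.+1) : nat *l nat) <= (m, d.+1))%O.
by rewrite lexi_pair /=; lia.
Qed.

(** [ord_pt n c.+1] is the immediate successor of [ord_pt n c]. *)
Lemma ord_pt_lt n c (b : ord_interval_top) :
  (ord_pt n c < b)%O = (ord_pt n c.+1 <= b)%O.
Proof.
case: b => -[a [m d]] b.
rewrite -[LHS]/(((0%N, (n, c.+1)) : nat *l (nat *l nat)) < (a, (m, d)))%O.
rewrite -[RHS]/(((0%N, (n, c.+2)) : nat *l (nat *l nat)) <= (a, (m, d)))%O.
by rewrite !(lexi_pair, ltxi_pair) /=; lia.
Qed.

Lemma lt_ord_pt n c (b : ord_interval_top) :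
  (b < ord_pt n c.+1)%O = (b <= ord_pt n c)%O.
Proof. by rewrite ltNge -ord_pt_lt leNgt. Qed.

(** Since both ends can be shifted by one successor step, the open interval is also a closed one. *)
Lemma clopen_ord_itv n c m d :
  clopen [set b | (ord_pt n c < b < ord_pt m d.+1)%O].
Proof.
split.
  rewrite (_ : [set _ | _] = `]ord_pt n c, ord_pt m d.+1[%classic).
    exact: itv_open.
  by apply/seteqP; split=> b /=; rewrite in_itv.
rewrite (_ : [set _ | _] = `[ord_pt n c.+1, ord_pt m d]%classic).
  exact: itv_closed.
by apply/seteqP; split=> b /=; rewrite in_itv /= ord_pt_lt lt_ord_pt.
Qed.

End ordinals.

Lemma not_embeds_SPR (F : numFieldType) (K : topologicalType) :
  compact [set: K] ->
  (exists p : K, derived_set (derived_set [set: K]) = [set p]) ->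
  (forall f : CK K F, attains_max f) ->
  (forall S : set F, S !=set0 -> (forall x, S x -> 0 <= x) ->
    infimums S !=set0) ->
  (forall c : F, 0 <= c -> exists n, c <= n%:R) ->
  ~ embeds_isometrically_SPR F ord_interval_top K.
Proof.
move=> cK [p Kp] maxK infF archiF [T [isoT]].
(* [U n] runs from omega * n + 2 to omega * (n + 1) + 1 inclusive: it contains the limit omega * (n
   + 1) and stops just before [U n.+1] starts. Its chosen isolated points are omega * n + c + 2. *)
pose U n : set ord_interval_top :=
  [set b | (ord_pt n 0 < b < ord_pt n.+1 1)%O].
apply: (@not_SPR_isometry _ _ _ T isoT cK maxK p Kp U
  (fun n c => ord_pt n c.+1)) => //.
- by move=> n; exact: clopen_ord_itv.
- apply: ltn_trivIset => m n mn; apply/eqP/negbNE/negP => /set0P[b []].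
  move=> /andP[mb bm] /andP[nb bn].
  move: bm; rewrite lt_ord_pt => /(lt_le_trans nb).
  by rewrite ltNge ord_pt_le; lia.
- move=> n c.
  rewrite (_ : [set _] = [set b | (ord_pt n c < b < ord_pt n c.+2)%O]).
    exact: clopen_ord_itv.
  apply/seteqP; split=> b /=.
    by move=> ->; rewrite ord_pt_lt lt_ord_pt lexx.
  by rewrite ord_pt_lt lt_ord_pt => /le_anti.
- by move=> n c; rewrite /U /= ord_pt_lt lt_ord_pt !ord_pt_le; lia.
- by move=> n c d /(congr1 val)[].
Qed.

Theorem proposition4p7 (R : realType) (K : topologicalType)
    (K_compact : compact [set: K]) (K_hausdorff : hausdorff_space K)
    (K_derived2 : exists p : K, derived_set (derived_set [set: K]) = [set p]) :
  ~ embeds_isometrically_SPR R ord_interval_top K /\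
  ~ embeds_isometrically_SPR R[i] ord_interval_top K.
Proof.
have K0 : [set: K] !=set0 by have [p _] := K_derived2; exists p.
split; apply: not_embeds_SPR => //.
- by move=> f; exact: real_attains_max.
- exact: real_infimums.
- by move=> c _; exact: real_le_nat.
- by move=> f; exact: complex_attains_max.
- exact: complex_infimums.
- exact: complex_le_nat.
Qed.
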